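(* For any real $p>0$ and any $m\in\mathbb{N}$, the function $S_p$ satisfies the functional equation $$S_p(x)=\sum_{k=0}^{m-1}\left(\frac{T_0(2^k x)}{2^k}\right)^p+\frac{S_p(2^m x)}{2^{mp}},\quad x\in\mathbb{R}.$$
   Context: $T_0(x)$ denotes the distance from the real number $x$ to the nearest integer: $T_0(x)=|x-[x+1/2]|=\min_{m\in\mathbb{Z}}|x-m|$. For real $p>0$, $S_p(x)=\sum_{n=0}^{\infty}\left(\frac{T_0(2^n x)}{2^n}\right)^p$ for $x\in\mathbb{R}$ (a convergent series). $\mathbb{N}$ is the set of positive integers. *)

(* Defs.v *)
From mathcomp Require Import all_boot all_order all_algebra.
From mathcomp Require Import all_classical all_reals all_analysis.
Set Implicit Arguments.
Unset Strict Implicit.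
Unset Printing Implicit Defensive.
Import Order.TTheory GRing.Theory Num.Theory.
Import numFieldNormedType.Exports.
Local Open Scope ring_scope.

Definition T0 (R : realType) (x : R) : R :=
  `|x - (Num.floor (x + 2^-1))%:~R|.

(* [powR] is the real power, with 0 `^ p = 0 for p != 0. *)
Definition Sterm (R : realType) (p x : R) (n : nat) : R :=
  (T0 (2 ^+ n * x) / 2 ^+ n) `^ p.

(* For p > 0 the n-th term lies between 0 and (2 `^ (- p)) ^+ n, so the limit
   of the partial sums exists. *)
Definition Sp (R : realType) (p x : R) : R :=
  limn (series (Sterm p x)).

(* Main.v *)
Require Import Defs.
From mathcomp Require Import all_boot all_order all_algebra.
From mathcomp Require Import all_classical all_reals all_analysis.
From mathcomp Require Import lra.
Import Order.TTheory GRing.Theory Num.Theory.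
Import numFieldNormedType.Exports.
Local Open Scope ring_scope.

(** Since 2^(n+m) x = 2^n (2^m x), the terms of the series at x from index m on are those of the
    series at 2^m x, scaled by 2^(-mp) ([Sterm_addn]). Splitting off the first m terms and passing
    to the limit gives the equation; the limit exists by [is_cvg_Sp]. *)

Lemma T0_le1 (R : realType) (x : R) : T0 x <= 1.
Proof.
have := floor_itv (x + 2^-1); rewrite intrD => /andP[h1 h2].
by rewrite /T0 ler_norml; apply/andP; split; lra.
Qed.

(** Comparison with the geometric series of ratio (1/2)^p, which is below 1 because p > 0; the crude
    bound [T0_le1] suffices. *)
Lemma is_cvg_Sp (R : realType) (p x : R) :
  0 < p -> cvgn (series (Sterm p x)).
Proof.
move=> p_gt0.
have q_lt1 : `|2^-1 `^ p| < 1 :> R.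
  (* The bound 1 is recast as 1^p, so that strict monotonicity of t^p in t applies. *)
  rewrite ger0_norm ?powR_ge0// -[ltRHS]/((fun=> 1) p) -powR1.
  by rewrite gt0_ltr_powR// ?nnegrE ?invf_lt1// ?invr_ge0 ?ltr1n.
apply: (series_le_cvg _ _ _ (@is_cvg_geometric_series _ 1 _ q_lt1)) => n /=.
- exact: powR_ge0.
- by rewrite mul1r exprn_ge0 ?powR_ge0.
(* Exchanging exponents turns ((1/2)^p)^n into ((1/2)^n)^p, so only the bases remain to be
   compared. *)
- rewrite mul1r -powR_mulrn ?powR_ge0// powRAC powR_mulrn ?invr_ge0//.
  rewrite ge0_ler_powR ?(ltW p_gt0)// ?nnegrE ?divr_ge0 ?normr_ge0 ?exprn_ge0 ?invr_ge0//.
  by rewrite exprVn ler_piMl ?T0_le1// invr_ge0 exprn_ge0.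
Qed.

Lemma Sterm_addn (R : realType) (p x : R) (m n : nat) :
  Sterm p x (n + m) = Sterm p (2 ^+ m * x) n / 2 `^ (m%:R * p).
Proof.
have T0_ge0 y : 0 <= T0 y :> R by exact: normr_ge0.
rewrite /Sterm powRrM powR_mulrn// mulrA -exprD exprD invfM mulrA.
rewrite powRM ?divr_ge0 ?invr_ge0 ?exprn_ge0//; congr (_ * _).
(* The inverse, written as the power -1, commutes with the power p. *)
by rewrite -powR_inv1 ?exprn_ge0// powRAC powR_inv1 ?powR_ge0.
Qed.

Theorem theorem3 (R : realType) (p : R) (hp : 0 < p) (m : nat) (hm : (0 < m)%N)
    (x : R) :
  Sp p x = \sum_(0 <= k < m) (T0 (2 ^+ k * x) / 2 ^+ k) `^ p
             + Sp p (2 ^+ m * x) / 2 `^ (m%:R * p).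
Proof.
apply: cvg_lim => //.
(* Shifting by m keeps the limit and makes the identity exact for every partial sum. *)
rewrite -(cvg_shiftn m).
have -> : (fun n => series (Sterm p x) (n + m)%N) =
    (fun n => \sum_(0 <= k < m) (T0 (2 ^+ k * x) / 2 ^+ k) `^ p +
       series (Sterm p (2 ^+ m * x)) n / 2 `^ (m%:R * p)).
  apply/funext => n; rewrite /series /= (@big_cat_nat _ _ _ m) ?leq_addl//=.
  rewrite -{2}[m]add0n big_addn addnK mulr_suml; congr (_ + _).
  by apply: eq_bigr => k _; rewrite Sterm_addn.
apply: cvgD; first exact: cvg_cst.
by apply: cvgMr_tmp; exact: is_cvg_Sp.
Qed.
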